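(* Let $p,m,k\ge 1$ be integers. For every integer $n\ge pm(k-1)$, the number $\mathcal{H}_{p,n}^{m,k}$ is given by each of the following three formulas: $$\mathcal{H}_{p,n}^{m,k}=\sum_{j\ge 0}\binom{m+j-2}{j}\binom{n+mp+m-pk-1}{k-j}(-p-1)^j,$$ $$\mathcal{H}_{p,n}^{m,k}=\sum_{j\ge 0}\binom{n+mp-(p+1)k+j}{j}\binom{n+mp+m-pk-1}{k-j}(p+1)^j(-p)^{k-j},$$ $$\mathcal{H}_{p,n}^{m,k}=\sum_{j\ge 0}\frac{n-pj}{k}\binom{m+j-1}{j}\binom{n+mp+m-pk-1}{k-j-1}(-p-1)^j.$$ Moreover, for every integer $n\ge mpk+1$, $$\mathcal{G}_{p,n}^{m,k}=\frac{n}{n-pk}\binom{n-pk}{k}.$$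
   Context: Let $n$ objects $x_1,\dots,x_n$ be arrayed in a line (this array is denoted $[n]$) or in a circle in this cyclic order (denoted $[\overline{n}]$). For integers $m,p\ge 1$ let $N_m^p=\mathbb{N}\setminus\{m-1,2m-1,\dots,pm-1\}$, where $\mathbb{N}$ is the set of nonnegative integers. A subset $A$ of $[n]$ or $[\overline{n}]$ is called $N_m^p$-separate if, whenever two distinct objects of $A$ have exactly $j$ objects between them, $j\in N_m^p$. On the line, $x_a$ and $x_b$ ($a\neq b$) have exactly $|a-b|-1$ objects between them, so the condition is $|a-b|\notin\{m,2m,\dots,pm\}$ for all distinct $x_a,x_b\in A$. On the circle both arcs count (they contain $|a-b|-1$ and $n-|a-b|-1$ objects), so the condition is that neither $|a-b|$ nor $n-|a-b|$ lies in $\{m,2m,\dots,pm\}$, for all distinct $x_a,x_b\in A$. $\mathcal{H}_{p,n}^{m,k}$ (resp. $\mathcal{G}_{p,n}^{m,k}$) denotes the number of $N_m^p$-separate $k$-element subsets of $[n]$ (resp. $[\overline{n}]$). Binomial coefficients are generalized: for an arbitrary number $a$ and an integer $j\ge 0$, $\binom{a}{j}=a(a-1)\cdots(a-j+1)/j!$ (so $\binom{a}{0}=1$), and $\binom{a}{j}=0$ for integers $j<0$. The sums over $j\ge 0$ are therefore finite; where a lower index $k-j$ is negative, the whole term is $0$. *)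

(* Defs.v *)
From mathcomp Require Import all_boot all_order all_algebra.
From mathcomp Require Import classical_sets fsbigop.

Set Implicit Arguments.
Unset Strict Implicit.
Unset Printing Implicit Defensive.

Import Order.TTheory GRing.Theory Num.Theory.

(* The set N \ {m-1, 2m-1, .., pm-1}; the truncated predecessor is harmless
   for m > 0. *)
Definition Nset (p m : nat) : pred nat :=
  [pred j | [forall i : 'I_p, j != (i.+1 * m).-1]].

(* The object x_(a+1) is represented by a : 'I_n. *)
Definition line_separate (p m n : nat) (A : {set 'I_n}) : bool :=
  [forall a in A, forall b in A,
    (a < b)%N ==> ((b - a).-1 \in Nset p m)].

Definition circle_separate (p m n : nat) (A : {set 'I_n}) : bool :=
  [forall a in A, forall b in A,
    (a < b)%N ==>
    ((b - a).-1 \in Nset p m) && ((n - (b - a)).-1 \in Nset p m)].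

Definition Hnum (p m n k : nat) : nat :=
  #|[set A : {set 'I_n} | (#|A| == k) && line_separate p m A]|.

Definition Gnum (p m n k : nat) : nat :=
  #|[set A : {set 'I_n} | (#|A| == k) && circle_separate p m A]|.

Local Open Scope ring_scope.

Definition gbinom (R : numFieldType) (a : R) (j : int) : R :=
  match j with
  | Posz l => (\prod_(i < l) (a - i%:R)) / l`!%:R
  | Negz _ => 0
  end.

(* Main.v *)
From mathcomp Require Import classical_sets fsbigop.
From mathcomp Require Import all_boot all_order all_algebra.
From mathcomp Require Import zify ring.
Require Import Defs.

Import Order.TTheory GRing.Theory Num.Theory.
Local Open Scope ring_scope.

(** Call two objects adjacent when a separate set may not contain both of
    them; the separate sets are the independent sets of this graph, counted
    according to size by its independence polynomial.  On the line the graph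
    splits into the m residue classes modulo m, in each of which objects are
    adjacent when they are at most p steps apart; the lengths L of the classes
    add up to n.  Such a path has binom(L + p - p j, j) independent sets of
    size j ([indep_poly_path], [coef_path_poly]).  On the circle, stepping by m
    splits the graph into d = gcd(m, n) cycles of length l = n / d, each of
    which has l / (l - p j) binom(l - p j, j) independent sets of size j
    ([indep_poly_cycle], [coef_cycle_poly]).  These counts hold for
    p j <= L + p and for p j < l respectively; the lower bounds on n guarantee
    this for all j <= k.  Independence polynomials multiply over disjoint unions
    of graphs ([indep_poly_bigcup]).

    It remains to convolve these numbers.  Let A_k(r, m) be the coefficient of
    w^k in (1 + w)^(r + m - 1 - p k) (1 + (p + 1) w)^(-(m - 1)).  The numbers
    for a path are A_j(L + p, 1), those for a cycle are A_j(l, 0).  By Lagrange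
    inversion, if w = z (1 + w)^(-p) and B = 1 + w, then A_k(r, m) is the
    coefficient of z^k in B^r (1 + p - p / B)^(-m), so that A(r, m) convolved
    with A(s, m') should be A(r + s, m + m').  This is proved here for m = 0
    and m = 1 ([sepcoef_conv0], [sepcoef_conv1]) without inversion, from the
    two recurrences
      A_k(r + 1, m) = A_k(r, m) + A_(k-1)(r - p, m),
      (p + 1) A_k(r, m + 1) - p A_k(r - 1, m + 1) = A_k(r, m)
    and from A_k(0, 0) = 0 for k > 0.  Consequently the number of separate
    k-sets is A_k(n + m p, m) on the line ([Hnum_sepcoef]) and A_k(n, 0) on the
    circle ([Gnum_sepcoef]).

    The first formula for the line is the expansion of A_k(n + m p, m).  The
    second one comes from the substitution w = v / (1 - (p + 1) v)
    ([conv_nbin_sbin]), and the third one from k [w^k] F = [w^(k-1)] F'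
    ([mul_conv_ncoef]). *)

(** * Convolution of sequences *)

(** The Cauchy product of two sequences, that is, the product of their
    generating functions. *)
Definition conv (u v : nat -> rat) (k : nat) : rat :=
  \sum_(j < k.+1) u j * v (k - j)%N.

(** Multiplication of the generating function by the variable. *)
Definition shift (u : nat -> rat) (k : nat) : rat :=
  if k is k'.+1 then u k' else 0.

Lemma conv_coef (N : nat) (u v : nat -> rat) (k : nat) : (k < N)%N ->
  conv u v k = ((\poly_(i < N) u i) * (\poly_(i < N) v i))`_k.
Proof.
move=> kN; rewrite coefM; apply: eq_bigr => -[j hj] _ /=.
by rewrite !coef_poly !ifT //; lia.
Qed.

Lemma eq_conv (u u' v v' : nat -> rat) (k : nat) :
  (forall j, (j <= k)%N -> u j = u' j) -> (forall j, (j <= k)%N -> v j = v' j) ->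
  conv u v k = conv u' v' k.
Proof.
move=> hu hv; apply: eq_bigr => -[j hj] _ /=; rewrite hu ?hv //; lia.
Qed.

Lemma convC (u v : nat -> rat) (k : nat) : conv u v k = conv v u k.
Proof. by rewrite !(conv_coef k.+1) // mulrC. Qed.

Lemma convA (u v w : nat -> rat) (k : nat) :
  conv u (conv v w) k = conv (conv u v) w k.
Proof.
pose P (x : nat -> rat) := \poly_(i < k.+1) x i.
transitivity ((P u * (P v * P w))`_k).
  rewrite coefM; apply: eq_bigr => -[j hj] _ /=.
  by rewrite /P coef_poly hj (conv_coef k.+1) //; lia.
rewrite mulrA coefM; apply: eq_bigr => -[j hj] _ /=.
rewrite /P (conv_coef k.+1) // [in X in _ * X]coef_poly ifT //; lia.
Qed.

Lemma convDl (u v w : nat -> rat) (k : nat) :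
  conv (fun j => u j + v j) w k = conv u w k + conv v w k.
Proof. by rewrite /conv -big_split; apply: eq_bigr => j _; rewrite mulrDl. Qed.

Lemma convZl (a : rat) (u v : nat -> rat) (k : nat) :
  conv (fun j => a * u j) v k = a * conv u v k.
Proof. by rewrite /conv big_distrr; apply: eq_bigr => j _; rewrite /= mulrA. Qed.

Lemma convDr (u v w : nat -> rat) (k : nat) :
  conv u (fun j => v j + w j) k = conv u v k + conv u w k.
Proof. by rewrite convC convDl !(convC _ u). Qed.

Lemma convZr (a : rat) (u v : nat -> rat) (k : nat) :
  conv u (fun j => a * v j) k = a * conv u v k.
Proof. by rewrite convC convZl !(convC _ u). Qed.

Lemma conv_shiftl (u v : nat -> rat) (k : nat) :
  conv (shift u) v k = shift (conv u v) k.
Proof.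
case: k => [|k]; first by rewrite /conv big_ord1 mul0r.
by rewrite /conv big_ord_recl mul0r add0r; apply: eq_bigr => j _ /=.
Qed.

Lemma conv_shiftr (u v : nat -> rat) (k : nat) :
  conv u (shift v) k = shift (conv u v) k.
Proof. by rewrite convC conv_shiftl; case: k => //= k; rewrite convC. Qed.

(** The sequence of generating function 1. *)
Definition delta0 (j : nat) : rat := (j == 0%N)%:R.

Lemma conv_delta (u : nat -> rat) (k : nat) : conv delta0 u k = u k.
Proof.
rewrite /conv big_ord_recl /delta0 /= subn0 mul1r big1 ?addr0 // => j _.
by rewrite mul0r.
Qed.

(** The Leibniz rule for w d/dw. *)
Lemma mul_conv (u v : nat -> rat) (k : nat) :
  k%:R * conv u v k = conv (fun j => j%:R * u j) v k + conv u (fun j => j%:R * v j) k.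
Proof.
rewrite /conv big_distrr -big_split; apply: eq_bigr => -[j hj] _ /=.
have -> : k%:R = j%:R + (k - j)%:R :> rat by rewrite -natrD; congr _%:R; lia.
by ring.
Qed.

(** * Generalized binomial coefficients *)

(** The binomial coefficient a (a - 1) .. (a - j + 1) / j! as a sequence in j;
    its generating function is (1 + w)^a. *)
Definition bin (a : rat) (j : nat) : rat := gbinom a j.

Lemma bin0r (a : rat) : bin a 0 = 1.
Proof. by rewrite /bin /= big_ord0 divr1. Qed.

Lemma factq (n : nat) : n`!%:R != 0 :> rat.
Proof. by rewrite pnatr_eq0 -lt0n fact_gt0. Qed.

Lemma mul_binS (a : rat) (j : nat) :
  j.+1%:R * bin a j.+1 = (a - j%:R) * bin a j.
Proof.
rewrite /bin /= big_ord_recr /= factS natrM.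
have := factq j; have : j.+1%:R != 0 :> rat by rewrite pnatr_eq0.
by move=> h1 h2; field; rewrite h2 nat1r h1.
Qed.

Lemma mul_binS_pred (a : rat) (j : nat) :
  j.+1%:R * bin a j.+1 = a * bin (a - 1) j.
Proof.
rewrite /bin /= big_ord_recl /= factS natrM subr0.
rewrite [in RHS](eq_bigr (fun i : 'I_j => a - (bump 0 i)%:R)); last first.
  by move=> i _; rewrite /bump /= natrD opprD addrA.
have := factq j; have : j.+1%:R != 0 :> rat by rewrite pnatr_eq0.
by move=> h1 h2; field; rewrite h2 nat1r h1.
Qed.

(** Pascal's rule: (1 + w)^(a + 1) = (1 + w)^a (1 + w). *)
Lemma binSr (a : rat) (j : nat) : bin (a + 1) j = bin a j + shift (bin a) j.
Proof.
case: j => [|j] /=; first by rewrite !bin0r addr0.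
have h : j.+1%:R != 0 :> rat by rewrite pnatr_eq0.
apply: (mulfI h); rewrite mul_binS_pred addrK mulrDr mul_binS -mulrDl.
by congr (_ * _); rewrite -natr1; ring.
Qed.

Lemma bin_nat (n j : nat) : bin n%:R j = 'C(n, j)%:R.
Proof.
elim: n j => [|n IH] [|j]; rewrite ?bin0r ?bin0 //.
  rewrite bin0n /=; have h : j.+1%:R != 0 :> rat by rewrite pnatr_eq0.
  by apply: (mulfI h); rewrite mul_binS_pred mul0r mulr0.
by rewrite binS natrD -natr1 binSr /= !IH.
Qed.

(** * The coefficients A_k(r, m) *)

(** The coefficients of (1 + (p + 1) w)^(-(m - 1)), with
    binom(-(m - 1), j) (p + 1)^j written as binom(m + j - 2, j) (- p - 1)^j. *)
Definition ncoef (p : nat) (m : rat) (j : nat) : rat :=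
  bin (m + j%:R - 2) j * (- p%:R - 1) ^+ j.

Lemma ncoef_rec (p : nat) (m : rat) (j : nat) :
  ncoef p m j = ncoef p (m + 1) j + (p%:R + 1) * shift (ncoef p (m + 1)) j.
Proof.
case: j => [|j]; first by rewrite /ncoef !bin0r /= mulr0 addr0.
rewrite /ncoef /=.
have -> : m + 1 + j.+1%:R - 2 = (m + j.+1%:R - 2) + 1 by ring.
rewrite binSr /=.
have -> : m + 1 + j%:R - 2 = m + j.+1%:R - 2 by rewrite -natr1; ring.
by rewrite exprS; ring.
Qed.

(** The differential equation of F = (1 + (p + 1) w)^(-(m - 1)):
    w F' = - (p + 1) w ((m - 1) F + w F'). *)
Lemma mul_ncoef (p : nat) (m : rat) (j : nat) :
  j%:R * ncoef p m j =
  - (p%:R + 1) * shift (fun j => (m - 1) * ncoef p m j + j%:R * ncoef p m j) j.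
Proof.
case: j => [|j]; first by rewrite mul0r mulr0.
rewrite /ncoef /= mulrA mul_binS_pred.
have -> : m + j.+1%:R - 2 - 1 = m + j%:R - 2 by rewrite -natr1; ring.
by rewrite exprS -natr1; ring.
Qed.

(** The number A_k(r, m): the coefficient of w^k in
    (1 + w)^(r + m - 1 - p k) (1 + (p + 1) w)^(-(m - 1)).  The exponent depends
    on k, hence A(r, m) is not itself a convolution of two sequences. *)
Definition sepcoef (p : nat) (m : nat) (r : rat) (k : nat) : rat :=
  conv (ncoef p m%:R) (bin (r + m%:R - 1 - p%:R * k%:R)) k.

Lemma sepcoef_shift (p m : nat) (r : rat) (k : nat) :
  sepcoef p m (r + 1) k = sepcoef p m r k + shift (sepcoef p m (r - p%:R)) k.
Proof.
rewrite /sepcoef.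
have -> : r + 1 + m%:R - 1 - p%:R * k%:R = r + m%:R - 1 - p%:R * k%:R + 1 by ring.
rewrite (eq_conv _ (ncoef p m%:R) _ (fun j => bin (r + m%:R - 1 - p%:R * k%:R) j
   + shift (bin (r + m%:R - 1 - p%:R * k%:R)) j)) //; last by move=> j _; apply: binSr.
rewrite convDr conv_shiftr; congr (_ + _); case: k => //= k.
by congr (conv _ (bin _) _); rewrite -natr1; ring.
Qed.

(** This holds because (p + 1) (1 + w) - p = 1 + (p + 1) w. *)
Lemma sepcoef_down (p m : nat) (r : rat) (k : nat) :
  (p%:R + 1) * sepcoef p m.+1 r k - p%:R * sepcoef p m.+1 (r - 1) k = sepcoef p m r k.
Proof.
rewrite /sepcoef; set x := r + m%:R - 1 - p%:R * k%:R.
have -> : r - 1 + m.+1%:R - 1 - p%:R * k%:R = x by rewrite /x -natr1; ring.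
have -> : r + m.+1%:R - 1 - p%:R * k%:R = x + 1 by rewrite /x -natr1; ring.
rewrite (eq_conv _ (ncoef p m.+1%:R) (bin (x + 1))
  (fun j => bin x j + shift (bin x) j)) //;
  last by move=> j _; apply: binSr.
rewrite [RHS](eq_conv _
  (fun j => ncoef p m.+1%:R j + (p%:R + 1) * shift (ncoef p m.+1%:R) j) _ (bin x)) //;
  last by move=> j _; rewrite ncoef_rec (@natr1 _ m).
rewrite convDr convDl convZl conv_shiftl conv_shiftr; ring.
Qed.

Lemma sepcoef0 (p m : nat) (r : rat) : sepcoef p m r 0 = 1.
Proof. by rewrite /sepcoef /conv big_ord1 /ncoef !bin0r !mul1r. Qed.

Lemma ncoef1 (p j : nat) : ncoef p 1 j = delta0 j.
Proof.
case: j => [|j]; first by rewrite /ncoef bin0r expr0 mul1r.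
rewrite /ncoef.
have -> : 1 + j.+1%:R - 2 = j%:R :> rat by rewrite -natr1; ring.
by rewrite bin_nat bin_small // mul0r.
Qed.

Lemma ncoef0 (p j : nat) : ncoef p 0 j =
  delta0 j + (p%:R + 1) * shift delta0 j.
Proof.
by rewrite ncoef_rec add0r ncoef1; case: j => //= j; rewrite ncoef1.
Qed.

Lemma sepcoef_m0 (p : nat) (r : rat) (k : nat) :
  sepcoef p 0 r k.+1 = bin (r - p%:R * k.+1%:R) k.+1
                  + p%:R * bin (r - 1 - p%:R * k.+1%:R) k.
Proof.
rewrite /sepcoef; set x := _ - p%:R * _.
rewrite (eq_conv _ (fun j => delta0 j + (p%:R + 1) * shift delta0 j) _ (bin x)) //;
  last by move=> j _; apply: ncoef0.
rewrite convDl convZl conv_shiftl /= !conv_delta.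
have -> : r - p%:R * k.+1%:R = x + 1 by rewrite /x; ring.
have -> : r - 1 - p%:R * k.+1%:R = x by rewrite /x; ring.
by rewrite binSr /=; ring.
Qed.

Lemma sepcoef_m0E (p : nat) (r : rat) (k : nat) : r - p%:R * k%:R != 0 ->
  sepcoef p 0 r k = r / (r - p%:R * k%:R) * bin (r - p%:R * k%:R) k.
Proof.
move=> h; case: k h => [|k] h.
  by move: h; rewrite mulr0 subr0 => h; rewrite sepcoef0 bin0r divff ?mulr1.
have E := mul_binS_pred (r - p%:R * k.+1%:R) k.
rewrite sepcoef_m0.
have -> : r - 1 - p%:R * k.+1%:R = r - p%:R * k.+1%:R - 1 by ring.
set x := r - p%:R * k.+1%:R in h E *.
apply: (mulfI h); rewrite mulrDr [x * (p%:R * _)]mulrCA -E.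
rewrite [RHS](_ : _ = r * bin x k.+1); last by field.
have -> : r = x + p%:R * k.+1%:R by rewrite /x; ring.
by ring.
Qed.

Lemma sepcoef_00 (p k : nat) : sepcoef p 0 0 k = delta0 k.
Proof.
case: k => [|k]; first by rewrite sepcoef0.
rewrite sepcoef_m0 /delta0 /=.
have h : k.+1%:R != 0 :> rat by rewrite pnatr_eq0.
apply: (mulfI h); rewrite mulrDr mul_binS_pred mulr0.
have -> : 0 - 1 - p%:R * k.+1%:R = 0 - p%:R * k.+1%:R - 1 :> rat by ring.
by ring.
Qed.

Lemma shift_invariant (F : int -> rat) :
  (forall z, F (z + 1) = F z) -> F 0 = 0 -> forall z, F z = 0.
Proof.
move=> h h0; elim/int_ind => // n IH.
  by rewrite -addn1 PoszD h.
by rewrite -h -IH; congr F; lia.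
Qed.

(** Both sides satisfy the recurrence [sepcoef_shift] in z, and they agree at
    z = 0, where A(0, 0) is the unit of the convolution. *)
Lemma sepcoef_conv0 (p m : nat) (z : int) (s : rat) (k : nat) :
  conv (sepcoef p 0 z%:~R) (sepcoef p m s) k = sepcoef p m (z%:~R + s) k.
Proof.
elim: k z => [|k IH] z.
  by rewrite /conv big_ord1 !sepcoef0 mulr1.
pose F z := conv (sepcoef p 0 z%:~R) (sepcoef p m s) k.+1
  - sepcoef p m (z%:~R + s) k.+1.
suff : F z = 0 by move/eqP; rewrite subr_eq0 => /eqP.
apply: shift_invariant => [{}z|]; rewrite /F; last first.
  rewrite add0r (eq_conv _ delta0 _ (sepcoef p m s)) //; last
    by move=> j _; apply: sepcoef_00.
  by rewrite conv_delta subrr.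
rewrite rmorphD /=.
rewrite (eq_conv _
  (fun j => sepcoef p 0 z%:~R j + shift (sepcoef p 0 (z - p%:Z)%:~R) j) _
  (sepcoef p m s)) //; last first.
  by move=> j _; rewrite sepcoef_shift rmorphB.
rewrite convDl conv_shiftl /= IH.
have -> : z%:~R + 1 + s = z%:~R + s + 1 :> rat by ring.
rewrite sepcoef_shift /= rmorphB /=.
have -> : z%:~R + s - p%:R = z%:~R - p%:R + s :> rat by ring.
by ring.
Qed.

(** By [sepcoef_conv0] the left-hand side depends on z + y only.  It satisfies
    both recurrences [sepcoef_shift] and [sepcoef_down].  Hence, by induction on
    k, the difference F of the two sides is invariant under translation and
    satisfies (p + 1) F(u) = p F(u - 1), so it vanishes. *)
Lemma sepcoef_conv1 (p m : nat) (z y : int) (k : nat) :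
  conv (sepcoef p 1 z%:~R) (sepcoef p m y%:~R) k = sepcoef p m.+1 (z + y)%:~R k.
Proof.
(* A(w, 1) is A(0, 1) convolved with A(w, 0). *)
have red (w x : int) i : conv (sepcoef p 1 w%:~R) (sepcoef p m x%:~R) i =
    conv (sepcoef p 1 0) (sepcoef p m (w + x)%:~R) i.
  transitivity (conv (conv (sepcoef p 1 0) (sepcoef p 0 w%:~R)) (sepcoef p m x%:~R) i).
    apply: eq_conv => // j _.
    by rewrite convC sepcoef_conv0 addr0.
  rewrite -convA; apply: eq_conv => // j _.
  by rewrite sepcoef_conv0 rmorphD.
rewrite red; move: (z + y) => u {z y}.
elim: k u => [|k IH] u.
  by rewrite /conv big_ord1 !sepcoef0 mulr1.
pose F (z : int) := conv (sepcoef p 1 0) (sepcoef p m z%:~R) k.+1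
  - sepcoef p m.+1 z%:~R k.+1.
suff : F u = 0 by move/eqP; rewrite subr_eq0 => /eqP.
have Fs (z : int) : F (z + 1) = F z.
  rewrite /F rmorphD /= sepcoef_shift.
  rewrite (eq_conv _ (sepcoef p 1 0) _
    (fun j => sepcoef p m z%:~R j + shift (sepcoef p m (z - p%:Z)%:~R) j)) //;
    last first.
    by move=> j _; rewrite sepcoef_shift rmorphB.
  by rewrite convDr conv_shiftr /= IH rmorphB; ring.
have E1 := sepcoef_down p m u%:~R k.+1.
have E2 : (p%:R + 1) * conv (sepcoef p 1 0) (sepcoef p m u%:~R) k.+1
    - p%:R * conv (sepcoef p 1 0) (sepcoef p m (u - 1)%:~R) k.+1 =
        sepcoef p m u%:~R k.+1.
  rewrite -[in RHS](conv_delta (sepcoef p m u%:~R)).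
  rewrite [RHS](eq_conv _
    (fun j => (p%:R + 1) * sepcoef p 1 0 j + (- p%:R) * sepcoef p 1 (-1)%:~R j) _
    (sepcoef p m u%:~R)) //; last first.
    by move=> j _; rewrite -(sepcoef_00 p) -sepcoef_down sub0r mulNr.
  rewrite convDl !convZl red [-1 + u]addrC; ring.
have E3 := Fs (u - 1); rewrite subrK in E3.
have : (p%:R + 1) * F u - p%:R * F (u - 1) = 0.
  rewrite /F; rewrite rmorphB /= in E2 *.
  by rewrite -[RHS](subrr (sepcoef p m u%:~R k.+1)) -{1}E2 -E1; ring.
by rewrite -E3 => <-; ring.
Qed.

Lemma sepcoef_m1 (p : nat) (r : rat) (k : nat) : sepcoef p 1 r k =
  bin (r - p%:R * k%:R) k.
Proof.
rewrite /sepcoef (eq_conv _ delta0 _ (bin (r - p%:R * k%:R))).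
- by rewrite conv_delta.
- by move=> j _; apply: ncoef1.
- by move=> j _; rewrite addrK.
Qed.

(** * Transformations of the first sum *)

(** Reflection of the upper parameter. *)
Lemma bin_opp (x : rat) (j : nat) :
  bin (- x) j = (-1) ^+ j * bin (x + j%:R - 1) j.
Proof.
rewrite /bin /= mulrA; congr (_ / _).
rewrite [in RHS](reindex_inj rev_ord_inj) /= -[in (-1) ^+ j](card_ord j) -prodrN.
apply: eq_bigr => -[i hi] _ /=; rewrite natrB // -natr1; ring.
Qed.

(** The coefficients of (1 - q v)^(-(x + 1)). *)
Definition nbin (q x : rat) (j : nat) : rat := bin (x + j%:R) j * q ^+ j.

(** The coefficients of (1 + r v)^a. *)
Definition sbin (r a : rat) (j : nat) : rat := bin a j * r ^+ j.

Lemma nbinS (q x : rat) (j : nat) :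
  nbin q (x + 1) j = nbin q x j + q * shift (nbin q (x + 1)) j.
Proof.
case: j => [|j]; first by rewrite /nbin !bin0r /= mulr0 addr0.
rewrite /nbin /=.
have -> : x + 1 + j.+1%:R = x + j.+1%:R + 1 by ring.
rewrite binSr /=.
have -> : x + 1 + j%:R = x + j.+1%:R by rewrite -natr1; ring.
by rewrite exprS; ring.
Qed.

Lemma sbinS (r a : rat) (j : nat) :
  sbin r (a + 1) j = sbin r a j + r * shift (sbin r a) j.
Proof.
rewrite /sbin binSr; case: j => [|j] /=; first by rewrite mulr0 !addr0.
by rewrite exprS; ring.
Qed.

(** The coefficient of w^k in (1 + w)^a (1 + (p + 1) w)^(-c), with c = m - 1,
    is that of v^k in (1 - p v)^a (1 - (p + 1) v)^(c + k - a - 1).  Both sides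
    satisfy X_k(a + 1) = X_k(a) + X_(k-1)(a), and they agree at a = 0. *)
Lemma conv_nbin_sbin (p m a k : nat) :
  conv (nbin (p%:R + 1) (a%:R - (m%:R - 1) - k%:R)) (sbin (- p%:R) a%:R) k =
  conv (ncoef p m%:R) (bin a%:R) k.
Proof.
elim: k a => [|k IHk] a.
  by rewrite /conv !big_ord1 /ncoef /nbin /sbin !bin0r.
elim: a => [|a IHa].
  rewrite convC [RHS]convC.
  rewrite (eq_conv _ delta0 _ (nbin (p%:R + 1) (0 - (m%:R - 1) - k.+1%:R))) //;
    last first.
    move=> [|j] _; first by rewrite /sbin bin0r mul1r.
    by rewrite /sbin (bin_nat 0) mul0r.
  rewrite [RHS](eq_conv _ delta0 _ (ncoef p m%:R)) //; last first.
    by move=> [|j] _; rewrite ?bin0r // (bin_nat 0).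
  rewrite !conv_delta /nbin /ncoef.
  have -> : 0 - (m%:R - 1) - k.+1%:R + k.+1%:R = - (m%:R - 1) :> rat by ring.
  rewrite bin_opp.
  have -> : m%:R - 1 + k.+1%:R - 1 = m%:R + k.+1%:R - 2 :> rat by ring.
  have -> : - p%:R - 1 = -1 * (p%:R + 1) :> rat by ring.
  by rewrite exprMn; ring.
set x := a%:R - (m%:R - 1) - k.+1%:R in IHa.
have -> : a.+1%:R - (m%:R - 1) - k.+1%:R = x + 1 by rewrite /x -natr1; ring.
rewrite -natr1.
rewrite [RHS](eq_conv _ (ncoef p m%:R) _ (fun j => bin a%:R j + shift (bin a%:R) j)) //;
  last by move=> j _; apply: binSr.
rewrite convDr conv_shiftr /= -IHk -IHa.
have -> : a%:R - (m%:R - 1) - k%:R = x + 1 by rewrite /x -natr1; ring.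
rewrite (eq_conv _ (nbin (p%:R + 1) (x + 1)) _
  (fun j => sbin (- p%:R) a%:R j + (- p%:R) * shift (sbin (- p%:R) a%:R) j)) //;
  last by move=> j _; apply: sbinS.
rewrite convDr convZr conv_shiftr /=.
rewrite {1}(eq_conv _
  (fun j => nbin (p%:R + 1) x j + (p%:R + 1) * shift (nbin (p%:R + 1) (x + 1)) j) _ (sbin (- p%:R) a%:R)) //;
  last by move=> j _; apply: nbinS.
rewrite convDl convZl conv_shiftl /=; ring.
Qed.

(** This is k [w^k] F = [w^(k-1)] F' for
    F = (1 + w)^a (1 + (p + 1) w)^(-(m - 1)), written in terms of the
    coefficients of (1 + (p + 1) w)^(-m). *)
Lemma mul_conv_ncoef (p m k : nat) (a : rat) :
  k.+1%:R * conv (ncoef p m%:R) (bin a) k.+1 =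
  conv (fun j => (a - k%:R + k.+1%:R * (p%:R + 1) - m%:R * (p%:R + 1) - p%:R * j%:R)
                 * ncoef p m.+1%:R j) (bin a) k.
Proof.
set q := p%:R + 1 : rat; pose d := ncoef p m.+1%:R.
set X := conv d (bin a) k.
pose Th := conv (fun j => j%:R * d j) (bin a) k.
rewrite (eq_conv _ (fun j => d j + q * shift d j) _ (bin a)) //; last first.
  by move=> j _; rewrite ncoef_rec (@natr1 _ m).
rewrite convDl convZl conv_shiftl /= -/X mulrDr mul_conv.
rewrite (eq_conv
  (fun j => j%:R * d j)
  (fun j => - q * shift
  (fun j => m%:R * d j + j%:R * d j) j) _ (bin a)) //; last first.
  move=> j _; rewrite /d mul_ncoef -/q; case: j => //= j.
  by rewrite -(@natr1 _ m) addrK.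
rewrite convZl conv_shiftl /= convDl convZl -/X -/Th.
rewrite (eq_conv d d
  (fun j => j%:R * bin a j) (shift
  (fun j => a * bin a j + -1 * (j%:R * bin a j)))) //; last first.
  move=> [|j] _ /=; first by rewrite mul0r.
  by rewrite mul_binS; ring.
rewrite conv_shiftr /= convDr !convZr -/X.
have E := mul_conv d (bin a) k; rewrite -/X -/Th in E.
have -> : conv d (fun j => j%:R * bin a j) k = k%:R * X - Th by rewrite E; ring.
rewrite -/q.
rewrite [RHS](eq_conv _
  (fun j => (a - k%:R + k.+1%:R * q - m%:R * q) * d j + (- p%:R) * (j%:R * d j)) _
  (bin a)) //; last first.
  by move=> j _; rewrite /d; ring.
rewrite convDl !convZl -/X -/Th /q; ring.
Qed.

(** * Independence polynomials *)

(** No two members of A, equal or not, are related by e. *)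
Definition independent {T : finType} (e : rel T) (A : {set T}) : bool :=
  [forall a in A, forall b in A, ~~ e a b].

(** The independence polynomial of the graph induced by e on S: the
    coefficient of X^k counts the independent sets of size k. *)
Definition indep_poly {T : finType} (e : rel T) (S : {set T}) : {poly rat} :=
  \sum_(A : {set T} | (A \subset S) && independent e A) 'X^#|A|.

Lemma independentP (T : finType) (e : rel T) (A : {set T}) :
  reflect {in A &, forall a b, ~~ e a b} (independent e A).
Proof.
apply: (iffP forall_inP) => [h a b aA bA|h a aA].
  by have /forall_inP := h _ aA; apply.
by apply/forall_inP=> b bA; apply: h.
Qed.

Lemma coef_indep_poly (T : finType) (e : rel T) (S : {set T}) (k : nat) :
  (indep_poly e S)`_k =
  #|[set A : {set T} | [&& A \subset S, independent e A & #|A| == k]]|%:R.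
Proof.
rewrite /indep_poly coef_sum -sum1dep_card natr_sum big_mkcondr /=.
rewrite [RHS]big_mkcond [LHS]big_mkcond /=; apply: eq_bigr => A _.
rewrite coefXn eq_sym.
by case: (A \subset S) => //=; case: (independent e A) => //=; case: (_ == _).
Qed.

Lemma indep_poly0 (T : finType) (e : rel T) : indep_poly e set0 = 1.
Proof.
rewrite /indep_poly (big_pred1 set0) ?cards0 ?expr0 // => A /=.
rewrite subset0; case: eqP => //= ->.
by apply/independentP => a b; rewrite inE.
Qed.

(** Deletion of a vertex: an independent set that contains v consists of v and
    of an independent set of non-neighbours of v. *)
Lemma indep_poly_delete (T : finType) (e : rel T) (S : {set T}) (v : T) :
  symmetric e -> ~~ e v v -> v \in S ->
  indep_poly e S = indep_poly e (S :\ v)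
    + 'X * indep_poly e [set w in S | (w != v) && ~~ e v w].
Proof.
move=> esym evv vS; rewrite /indep_poly (bigID (fun A : {set T} => v \in A)) /=.
rewrite addrC; congr (_ + _).
  by apply: eq_bigl => A; rewrite subsetD1 -!andbA; congr (_ && _); rewrite andbC.
rewrite big_distrr /=.
rewrite (reindex_onto (fun A : {set T} => v |: A) (fun A => A :\ v)) /=; last first.
  by move=> A /andP[_ vA]; rewrite setD1K.
apply: eq_big => [A|A]; last first.
  case/andP=> _ /eqP h; rewrite cardsU1.
  suff -> : v \notin A by rewrite add1n exprS.
  by rewrite -h !inE eqxx.
rewrite setU11 andbT; apply/idP/idP.
- case/andP=> /andP[hS /independentP hI] /eqP hv.
  have vA : v \notin A by rewrite -hv !inE eqxx.
  apply/andP; split.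
    apply/subsetP => a aA; rewrite inE; apply/and3P; split.
    + by move/subsetP: hS; apply; rewrite !inE aA orbT.
    + by apply: contraNneq vA => <-.
    + by apply: hI; rewrite !inE ?eqxx ?aA ?orbT.
  apply/independentP => a b aA bA.
  by apply: hI; rewrite !inE ?aA ?bA ?orbT.
- case/andP=> /subsetP hS /independentP hI.
  have vA : v \notin A.
    by apply/negP => /hS; rewrite inE eqxx andbF.
  have nb a : a \in A -> ~~ e v a by move=> /hS; rewrite inE => /and3P[].
  apply/andP; split; last by rewrite setU1K.
  apply/andP; split.
    rewrite subUset sub1set vS; apply/subsetP => a /hS.
    by rewrite inE => /andP[].
  apply/independentP => a b /setU1P[->|aA] /setU1P[->|bA] //.
  + exact: nb.
  + by rewrite esym; apply: nb.
  + exact: hI.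
Qed.

Lemma indep_polyU (T : finType) (e : rel T) (S S' : {set T}) :
  symmetric e -> irreflexive e ->
  {in S & S', forall a b, a != b /\ ~~ e a b} ->
  indep_poly e (S :|: S') = indep_poly e S * indep_poly e S'.
Proof.
move=> esym eirr.
have [N] := ubnP #|S|; elim: N S => // N IH S hN hSS'.
have [->|[v vS]] := set_0Vmem S; first by rewrite set0U indep_poly0 mul1r.
have vS' : v \notin S'.
  by apply/negP => /(hSS' v v vS)[]; rewrite eqxx.
rewrite (indep_poly_delete _ e S v) ?eirr //.
rewrite (indep_poly_delete _ e (S :|: S') v) ?eirr // ?inE ?vS //.
have -> : (S :|: S') :\ v = (S :\ v) :|: S'.
  by rewrite setDUl; congr (_ :|: _); apply/setDidPl; rewrite disjoint_sym disjoints1.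
have -> : [set w in S :|: S' | (w != v) && ~~ e v w] =
          [set w in S | (w != v) && ~~ e v w] :|: S'.
  apply/setP => w; rewrite !inE.
  case: (boolP (w \in S')) => [wS'|_]; last by rewrite !orbF.
  have [h1 h2] := hSS' _ _ vS wS'.
  by rewrite h2 eq_sym h1 !orbT.
have lt1 : (#|S :\ v| < N)%N.
  by move: hN; rewrite (cardsD1 v S) vS.
rewrite !IH //; last 1 first.
- by move=> a b; rewrite !inE => /andP[_ aS]; apply: hSS'.
- by rewrite mulrDl mulrA.
- apply: leq_ltn_trans lt1; apply/subset_leq_card/subsetP=> w.
  by rewrite !inE => /and3P[-> -> _].
- by move=> a b; rewrite !inE => /andP[aS _]; apply: hSS'.
Qed.

(** The fibres of a function c that is constant along edges are unions of
    connected components. *)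
Lemma indep_poly_bigcup (T : finType) (e : rel T) (d : nat) (c : T -> 'I_d) :
  symmetric e -> irreflexive e -> (forall a b, e a b -> c a = c b) ->
  indep_poly e [set: T] = \prod_(i < d) indep_poly e [set a | c a == i].
Proof.
move=> esym eirr ec.
suff H (r : seq 'I_d) : uniq r ->
   indep_poly e [set a | c a \in r] =
   \prod_(i <- r) indep_poly e [set a | c a == i].
  rewrite -H ?index_enum_uniq //; congr indep_poly.
  by apply/setP => a; rewrite !inE mem_index_enum.
elim: r => [_|i r IH /andP[ir ur]].
  by rewrite big_nil -(indep_poly0 T e); congr indep_poly; apply/setP=> a; rewrite !inE.
rewrite big_cons -IH // -indep_polyU //.
  by congr indep_poly; apply/setP => a; rewrite !inE.
move=> a b; rewrite !inE => /eqP ha hb; split.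
  by apply: contraNneq ir => ab; rewrite -ha ab.
by apply/negP => /ec h; rewrite -ha h hb in ir.
Qed.

(** * Powers of paths and cycles *)

(** The independence polynomial of the p-th power of a path with L vertices.
    The truncated subtraction yields the coefficient 0 for j > 0 whenever
    p j > L + p. *)
Definition path_poly (p L : nat) : {poly rat} :=
  \poly_(j < L.+1) 'C(L + p - p * j, j)%:R.

Lemma coef_path_poly (p L j : nat) :
  (path_poly p L)`_j = 'C(L + p - p * j, j)%:R.
Proof.
rewrite coef_poly; case: ltnP => // hj; rewrite bin_small //.
by case: j hj => // j hj; nia.
Qed.

Lemma path_poly0 (p : nat) : path_poly p 0 = 1.
Proof.
apply/polyP => -[|j]; rewrite coef_path_poly coefC ?bin0 //=.
by rewrite bin_small //; nia.
Qed.

Lemma path_polyS (p L : nat) :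
  path_poly p L.+1 = path_poly p L + 'X * path_poly p (L - p).
Proof.
apply/polyP => -[|j]; rewrite coefD coefXM !coef_path_poly /= ?bin0 ?addr0 //.
rewrite -natrD; congr (_ %:R).
have [h|h] := leqP (p * j) L.
  have -> : (L.+1 + p - p * j.+1 = (L - p * j).+1)%N by nia.
  have -> : (L + p - p * j.+1 = L - p * j)%N by nia.
  rewrite binS; congr (_ + _)%N.
  have [h2|h2] := leqP p L; first by congr 'C(_, _); nia.
  have -> : j = 0%N by case: j h => //; nia.
  by rewrite !bin0.
have j0 : (0 < j)%N by case: j h => //; nia.
by rewrite !bin_small //; nia.
Qed.

(** A p-th power of a path: f enumerates the vertices, which are adjacent when
    at most p apart.  Deletion of the last vertex gives the recurrence of
    [path_polyS]. *)
Lemma indep_poly_path (T : finType) (e : rel T) (p L : nat) (f : nat -> T) :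
  symmetric e -> irreflexive e ->
  (forall s t, (s < t < L)%N -> f t != f s /\ e (f t) (f s) = (t - s <= p)%N) ->
  indep_poly e [set f (val s) | s : 'I_L] = path_poly p L.
Proof.
move=> esym eirr; have [N] := ubnP L; elim: N L => // N IH [|L] hN hf.
  rewrite path_poly0 -(indep_poly0 T e); congr indep_poly.
  by apply/setP => a; rewrite inE; apply/imsetP => -[[]].
rewrite (indep_poly_delete _ e _ (f L)) ?eirr //; last first.
  by apply/imsetP; exists ord_max.
rewrite path_polyS; congr (_ + 'X * _).
  rewrite -IH //; last by move=> s t /andP[h1 h2]; apply: hf; lia.
  congr indep_poly; apply/setP => a; rewrite !inE; apply/andP/imsetP.
    case=> ha /imsetP[s _ E]; have hs := ltn_ord s.
    have hsL : (s < L)%N.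
      rewrite ltn_neqAle -ltnS hs andbT; apply: contraNneq ha => h.
      by rewrite E /= h.
    by exists (Ordinal hsL).
  case=> s _ ->; have hs := ltn_ord s; split.
    by have [] := hf s L; rewrite ?hs ?ltnSn // eq_sym.
  by apply/imsetP; exists (widen_ord (leqnSn L) s).
rewrite -IH; first last.
- by move=> s t /andP[h1 h2]; apply: hf; lia.
- by lia.
congr indep_poly; apply/setP => a; rewrite !inE; apply/and3P/imsetP.
  case=> /imsetP[s _ ->] ha hb; have hs := ltn_ord s.
  have hsL : (s < L)%N.
    rewrite ltn_neqAle -ltnS hs andbT; apply: contraNneq ha => h.
    by rewrite /= h.
  case: (hf s L); first by rewrite hsL ltnSn.
  move=> _ E.
  rewrite E -ltnNge in hb.
  have hs' : (s < L - p)%N by lia.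
  by exists (Ordinal hs').
case=> s _ ->; have hs := ltn_ord s.
have hsL : (s < L)%N by lia.
have /hf[h1 h2] : (s < L < L.+1)%N by rewrite hsL ltnSn.
split; first by apply/imsetP; exists (widen_ord (leqnSn L) (Ordinal hsL)).
  by rewrite eq_sym.
rewrite h2 -ltnNge; lia.
Qed.

(** A p-th power of a cycle of length l.  An independent set contains at most
    one of p consecutive vertices: if it contains none of them, a path with
    l - p vertices remains, and if it contains one of them, a path with
    l - 2 p - 1 vertices remains (an empty one if this is negative). *)
Lemma indep_poly_cycle (T : finType) (e : rel T) (p l : nat) (f : nat -> T) :
  (p < l)%N -> symmetric e -> irreflexive e ->
  (forall s t, (s < t < l)%N -> f t != f s /\
      e (f t) (f s) = (t - s <= p)%N || (l - (t - s) <= p)%N) ->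
  indep_poly e [set f (val s) | s : 'I_l] =
  path_poly p (l - p) + 'X * path_poly p (l - p.*2.+1) *+ p.
Proof.
move=> pl esym eirr hf.
(* U t consists of the vertices that remain once f 0, .., f (t - 1) are
   deleted. *)
pose U t := [set f (t + val s)%N | s : 'I_(l - t)].
have inU t a : reflect (exists2 s, (t <= s < l)%N & a = f s) (a \in U t).
  apply: (iffP imsetP) => [[s _ ->]|[s hs ->]].
    by exists (t + s)%N => //; have := ltn_ord s; lia.
  have hst : (s - t < l - t)%N by lia.
  by exists (Ordinal hst) => //=; congr f; lia.
have step t : (t < p)%N -> indep_poly e (U t) =
    indep_poly e (U t.+1) + 'X * path_poly p (l - p.*2.+1).
  move=> tp; rewrite (indep_poly_delete _ e _ (f t)) ?eirr //; last first.
    by apply/inU; exists t => //; lia.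
  congr (indep_poly e _ + 'X * _).
    apply/setP => a; rewrite !inE; apply/andP/inU.
      case=> ha /inU[s hs E]; exists s => //.
      have : s != t by apply: contraNneq ha => <-; rewrite E.
      by lia.
    case=> s hs ->; split; last by apply/inU; exists s => //; lia.
    by have /hf[] : (t < s < l)%N by lia.
  rewrite -(@indep_poly_path T e p _ (fun s => f (t + p.+1 + s)%N)) //; last first.
    move=> s s' hs.
    have /hf[-> ->] : (t + p.+1 + s < t + p.+1 + s' < l)%N by lia.
    by split=> //; lia.
  congr indep_poly; apply/setP => a; rewrite !inE; apply/and3P/imsetP.
    case=> /inU[s hs ->] ha hb.
    have ts : (t < s)%N.
      have : s != t by apply: contraNneq ha => <-.
      by lia.
    have /hf[_ E] : (t < s < l)%N by lia.
    rewrite esym E negb_or -!ltnNge in hb; have {hb} /andP[h1 h2] := hb.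
    have hss : (s - (t + p.+1) < l - p.*2.+1)%N by lia.
    by exists (Ordinal hss) => //=; congr f; lia.
  case=> s _ ->; have hs := ltn_ord s;
    have /hf[h1 h2] : (t < t + p.+1 + s < l)%N by lia.
  split=> //.
  - by apply/inU; exists (t + p.+1 + s)%N => //; lia.
  - by rewrite esym h2; lia.
have stepn t : (t <= p)%N -> indep_poly e (U 0) =
    indep_poly e (U t) + 'X * path_poly p (l - p.*2.+1) *+ t.
  elim: t => [|t IH] ht; first by rewrite mulr0n addr0.
  by rewrite IH ?(ltnW ht) // step // -addrA -mulrS.
transitivity (indep_poly e (U 0)).
  congr indep_poly; apply/setP => a; apply/imsetP/inU.
    by case=> s _ ->; exists (val s) => //; rewrite /= ltn_ord.
  by case=> s hs ->; exists (Ordinal hs).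
rewrite (stepn p) //; congr (_ + _);
  apply: (@indep_poly_path T e p (l - p) (fun s => f (p + s)%N)) => // s t hst.
have /hf[h1 h2] : (p + s < p + t < l)%N by lia.
by split=> //; rewrite h2; lia.
Qed.

(** * Counting in unions of paths and of cycles *)

Lemma coef_path_poly_sepcoef (p L j : nat) : (p * j <= L + p)%N ->
  (path_poly p L)`_j = sepcoef p 1 (L + p)%:R j.
Proof. by move=> h; rewrite coef_path_poly sepcoef_m1 -bin_nat natrB // natrM. Qed.

Lemma coefM_conv (P Q : {poly rat}) (k : nat) :
  (P * Q)`_k = conv (fun j => P`_j) (fun j => Q`_j) k.
Proof. exact: coefM. Qed.

Lemma coef_prod_path_poly (p m k : nat) (L : 'I_m -> nat) :
  (forall i, p * k <= L i + p)%N ->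
  (\prod_(i < m) path_poly p (L i))`_k =
  sepcoef p m (\sum_(i < m) L i + m * p)%:R k.
Proof.
elim: m k L => [|m IH] k L hL.
  by rewrite !big_ord0 sepcoef_00 coef1.
rewrite !big_ord_recl coefM_conv.
have -> : (L ord0 + \sum_(i < m) L (lift ord0 i) + m.+1 * p =
          (L ord0 + p) + (\sum_(i < m) L (lift ord0 i) + m * p))%N by lia.
rewrite -[LHS](_ : conv (sepcoef p 1 (L ord0 + p)%N%:~R)
   (sepcoef p m (\sum_(i < m) L (lift ord0 i) + m * p)%N%:~R) k = _).
  by rewrite sepcoef_conv1.
apply: eq_conv => j hj.
- by rewrite coef_path_poly_sepcoef //; apply: leq_trans (hL ord0);
    rewrite leq_mul2l hj orbT.
- rewrite IH // => i; apply: leq_trans (hL (lift ord0 i)).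
  by rewrite leq_mul2l hj orbT.
Qed.

Lemma coef_cycle_poly (p l k : nat) : (p * k < l)%N ->
  (path_poly p (l - p) + 'X * path_poly p (l - p.*2.+1) *+ p)`_k = sepcoef p 0 l%:R k.
Proof.
rewrite coefD coefMn coefXM !coef_path_poly.
case: k => [|k] h; first by rewrite bin0 sepcoef0 mul0rn addr0.
rewrite -[X in _ + X]mulr_natl sepcoef_m0 /=; congr (_ + _); last congr (_ * _).
  rewrite -bin_nat; congr (bin _ _).
  have -> : (l - p + p - p * k.+1 = l - p * k.+1)%N by nia.
  by rewrite natrB ?natrM //; lia.
have -> : l%:R - 1 - p%:R * k.+1%:R = (l - 1 - p * k.+1)%N%:R :> rat.
  by rewrite !natrB ?natrM //; lia.
rewrite bin_nat; congr (_%:R).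
case: k h => [|k] h; first by rewrite !bin0.
by congr 'C(_, _); nia.
Qed.

Lemma coef_cycle_polyX (p l k d : nat) : (p * k < l)%N ->
  ((path_poly p (l - p) + 'X * path_poly p (l - p.*2.+1) *+ p) ^+ d)`_k =
  sepcoef p 0 (d * l)%:R k.
Proof.
elim: d k => [|d IH] k h; first by rewrite expr0 sepcoef_00 coef1.
rewrite exprS coefM_conv mulSn.
rewrite (eq_conv _ (sepcoef p 0 l%:R) _ (sepcoef p 0 (d * l)%:R)).
- by rewrite (sepcoef_conv0 p 0 l) natrD.
- by move=> j hj; rewrite coef_cycle_poly //; apply: leq_ltn_trans h;
    rewrite leq_mul2l hj orbT.
- by move=> j hj; rewrite IH //; apply: leq_ltn_trans h; rewrite leq_mul2l hj orbT.
Qed.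

(** * Separate sets as independent sets *)

(** Two objects of the line are adjacent when they are i m apart for some
    1 <= i <= p. *)
Definition line_edge (p m n : nat) : rel 'I_n :=
  [rel a b : 'I_n | [exists i : 'I_p, (a + i.+1 * m == b)%N || (b + i.+1 * m == a)%N]].

(** The same on the circle, where distances are taken modulo n. *)
Definition circle_edge (p m n : nat) : rel 'I_n :=
  [rel a b : 'I_n | [exists i : 'I_p,
     (a + i.+1 * m == b %[mod n])%N || (b + i.+1 * m == a %[mod n])%N]].

Lemma line_edgeC (p m n : nat) : symmetric (line_edge p m n).
Proof. by move=> a b; apply: eq_existsb => i; rewrite orbC. Qed.

Lemma circle_edgeC (p m n : nat) : symmetric (circle_edge p m n).
Proof. by move=> a b; apply: eq_existsb => i; rewrite orbC. Qed.

Lemma line_edgexx (p m n : nat) : (0 < m)%N -> irreflexive (line_edge p m n).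
Proof. by move=> hm a; apply/existsP => -[i]; rewrite orbb; nia. Qed.

Lemma circle_edgexx (p m n : nat) : (0 < m)%N -> (p * m < n)%N ->
  irreflexive (circle_edge p m n).
Proof.
move=> hm hn a; apply/existsP => -[i]; rewrite orbb -[X in _ == X %[mod _]]addn0.
have hi := ltn_ord i.
by rewrite eqn_modDl mod0n modn_small; nia.
Qed.

Lemma independent_line (p m n : nat) (A : {set 'I_n}) : (0 < m)%N ->
  independent (line_edge p m n) A = line_separate p m A.
Proof.
move=> hm; apply/independentP/forall_inP => h.
  move=> a aA; apply/forall_inP => b bA; apply/implyP => ab.
  rewrite inE; apply/forallP => i; apply: contraNneq (h _ _ aA bA) => E.
  by apply/existsP; exists i; nia.
have h' a b (i : 'I_p) : a \in A -> b \in A -> (a + i.+1 * m)%N != b.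
  move=> aA bA; apply/eqP => E.
  have /forall_inP/(_ b bA)/implyP := h a aA.
  have ab : (a < b)%N by nia.
  move/(_ ab); rewrite inE => /forallP/(_ i)/eqP; apply; nia.
move=> a b aA bA; apply/existsP => -[i].
by rewrite !(negPf (h' _ _ _ _ _)).
Qed.

Lemma modn_lt_double (x n : nat) : (x < n.*2)%N ->
  (x %% n = if x < n then x else x - n)%N.
Proof.
move=> h; case: ltnP => h2; first exact: modn_small.
by rewrite -{1}(subnK h2) modnDr modn_small //; lia.
Qed.

Lemma independent_circle (p m n : nat) (A : {set 'I_n}) :
  (0 < m)%N -> (p * m < n)%N ->
  independent (circle_edge p m n) A = circle_separate p m A.
Proof.
move=> hm hn; apply/independentP/forall_inP => h.
  move=> a aA; apply/forall_inP => b bA; apply/implyP => ab.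
  have hb := ltn_ord b.
  rewrite !inE; apply/andP; split; apply/forallP => i;
    apply: contraNneq (h _ _ aA bA) => E; apply/existsP; exists i; apply/orP.
    left; apply/eqP; congr (_ %% _)%N; nia.
  right; have -> : (b + i.+1 * m = a + n)%N by nia.
  by rewrite modnDr.
have h' a b (i : 'I_p) : a \in A -> b \in A -> (a < b)%N ->
    ((a + i.+1 * m != b) /\ (b + i.+1 * m != a + n))%N.
  move=> aA bA ab.
  have /forall_inP/(_ b bA)/implyP := h a aA.
  move/(_ ab); rewrite !inE => /andP[/forallP/(_ i)/eqP h1 /forallP/(_ i)/eqP h2].
  have hb := ltn_ord b.
  by split; apply/eqP; [contradict h1|contradict h2]; nia.
have h'' a b : a \in A -> b \in A -> (a < b)%N -> ~~ circle_edge p m n a b.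
  move=> aA bA ab; apply/existsP => -[i].
  have hi : (i.+1 * m < n)%N by have := ltn_ord i; nia.
  have ha := ltn_ord a; have hb := ltn_ord b.
  have [/eqP h1 /eqP h2] := h' _ _ i aA bA ab.
  rewrite !(@modn_lt_double (_ + _)) ?(modn_small ha) ?(modn_small hb); [|lia|lia].
  by case/orP => /eqP; case: ifP; lia.
move=> a b aA bA; case: (ltngtP a b) => [||/val_inj ->].
- exact: h''.
- by rewrite circle_edgeC; apply: h''.
- by rewrite circle_edgexx.
Qed.

(** * The line: residue classes *)

(** The i-th term is the number of objects of the line that are congruent to i
    modulo m. *)
Lemma sum_divn_residues (m n : nat) : (0 < m)%N ->
  (\sum_(i < m) (n + (m.-1 - i)) %/ m)%N = n.
Proof.
move=> hm.
rewrite (reindex_inj rev_ord_inj) /=.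
rewrite (eq_bigr (fun i : 'I_m => (n + i) %/ m)%N); last first.
  by move=> i _; congr ((_ + _) %/ _)%N; have := ltn_ord i; lia.
elim: n => [|n IH].
  by rewrite big1 // => i _; rewrite add0n divn_small.
rewrite -[in RHS]IH; case: m hm {IH} => // m _.
rewrite big_ord_recr big_ord_recl /= addn0.
have -> : (n.+1 + m = n + m.+1)%N by lia.
rewrite divnDr // divnn /= addn1 addnS addnC.
by under [in RHS]eq_bigr => i _ do rewrite /bump /= add1n addnS -addSn.
Qed.

(** The residue class of i is enumerated by s |-> i + s m. *)
Lemma indep_poly_line (p m n : nat) : (0 < m)%N ->
  indep_poly (line_edge p m n) [set: 'I_n] =
  \prod_(i < m) path_poly p ((n + (m.-1 - i)) %/ m)%N.
Proof.
move=> hm.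
(* The enumeration by [inord] needs a nonempty line. *)
case: n => [|n].
  rewrite big1 => [|i _].
    by rewrite -(indep_poly0 _ (line_edge p m 0)); congr indep_poly; apply/setP=> -[].
  by rewrite divn_small ?path_poly0 //; have := ltn_ord i; lia.
rewrite (indep_poly_bigcup _ _ _ (fun a : 'I_n.+1 => Ordinal (ltn_pmod a hm))).
- apply: eq_bigr => i _.
  have hi := ltn_ord i.
  have hs s : (s < (n.+1 + (m.-1 - i)) %/ m)%N = (i + s * m < n.+1)%N.
    by rewrite leq_divRL //; lia.
  rewrite -(indep_poly_path _ (line_edge p m n.+1) _ _ (fun s => inord (i + s * m))).
  + congr indep_poly; apply/setP => a; rewrite inE; apply/eqP/imsetP.
      move/(congr1 val) => /= E; have ha := ltn_ord a; have Ea := divn_eq a m.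
      have hq : (a %/ m < (n.+1 + (m.-1 - i)) %/ m)%N by rewrite hs; lia.
      exists (Ordinal hq) => //=; apply: val_inj; rewrite /= inordK; lia.
    case=> s _ ->; apply: val_inj => /=; rewrite inordK; last by rewrite -hs.
    by rewrite addnC modnMDl modn_small.
  + exact: line_edgeC.
  + exact: line_edgexx.
  + move=> s t; rewrite hs => /andP[st htn].
    have hsn : (i + s * m < n.+1)%N by nia.
    split; first by apply/eqP => /(congr1 val); rewrite /= !inordK //; nia.
    apply/existsP/idP => [[j]|h].
      rewrite !inordK //; have := ltn_ord j; nia.
    have hj : ((t - s).-1 < p)%N by lia.
    exists (Ordinal hj); rewrite /= !inordK //; apply/orP; right.
    apply/eqP; nia.
- exact: line_edgeC.
- exact: line_edgexx.
- move=> a b /existsP[i] /orP[]/eqP E; apply: val_inj; rewrite /= -E.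
    by rewrite addnC modnMDl.
  by rewrite addnC modnMDl.
Qed.

Lemma Hnum_sepcoef (p m k n : nat) : (0 < m)%N -> (0 < k)%N ->
  (p * m * (k - 1) <= n)%N ->
  (Hnum p m n k)%:R = sepcoef p m (n + m * p)%:R k :> rat.
Proof.
move=> hm hk hn.
transitivity ((indep_poly (line_edge p m n) [set: 'I_n])`_k).
  rewrite coef_indep_poly; congr (_%:R); apply: eq_card => A; rewrite !inE.
  by rewrite subsetT independent_line // andbC.
rewrite indep_poly_line // coef_prod_path_poly ?sum_divn_residues //.
move=> i.
suff : (p * (k - 1) <= (n + (m.-1 - i)) %/ m)%N by nia.
by rewrite leq_divRL //; lia.
Qed.

(** * The circle: orbits of the step m *)

Lemma eqn_modMr_gcd (m n x y : nat) : (0 < n)%N ->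
  (x * m == y * m %[mod n])%N = (x == y %[mod n %/ gcdn m n])%N.
Proof.
move=> hn.
wlog: x y / (y <= x)%N => [W|yx].
  by case: (leqP y x) => h; [|rewrite eq_sym [RHS]eq_sym]; apply: W => //; apply: ltnW.
have d0 : (0 < gcdn m n)%N by rewrite gcdn_gt0 hn orbT.
rewrite !eqn_mod_dvd ?leq_mul2r ?yx ?orbT // -mulnBl.
rewrite -[X in (X %| _)%N](divnK (dvdn_gcdr m n)).
rewrite -[X in (_ %| _ * X)%N](divnK (dvdn_gcdl m n)) mulnA dvdn_pmul2r //.
rewrite Gauss_dvdl // /coprime -(eqn_pmul2r d0) muln_gcdl !divnK ?dvdn_gcdl ?dvdn_gcdr //.
by rewrite gcdnC mul1n.
Qed.

(** For i < d = gcd(m, n), the map s |-> i + s m mod n enumerates the class of i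
    modulo d as a cycle of length n / d. *)
Lemma indep_poly_circle (p m n : nat) (d := gcdn m n) (l := (n %/ d)%N) :
  (0 < m)%N -> (p * m < n)%N ->
  indep_poly (circle_edge p m n) [set: 'I_n] =
  (path_poly p (l - p) + 'X * path_poly p (l - p.*2.+1) *+ p) ^+ d.
Proof.
move=> hm hpn.
have hn : (0 < n)%N by lia.
have d0 : (0 < d)%N by rewrite gcdn_gt0 hm.
have dm : (d <= m)%N by apply: dvdn_leq => //; apply: dvdn_gcdl.
have dn : (d %| n)%N by apply: dvdn_gcdr.
have En : (n = l * d)%N by rewrite /l divnK.
have pl : (p < l)%N by nia.
have modl x y : (x * m == y * m %[mod n])%N = (x == y %[mod l])%N.
  exact: eqn_modMr_gcd.
rewrite (indep_poly_bigcup _ _ _ (fun a : 'I_n => Ordinal (ltn_pmod a d0))).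
- rewrite -[d in RHS]card_ord -prodr_const.
  apply: eq_bigr => i _.
  pose f s : 'I_n := Ordinal (ltn_pmod (i + s * m) hn).
  rewrite -(indep_poly_cycle _ (circle_edge p m n) _ _ f) //.
  + congr indep_poly; apply/setP => a; rewrite inE; apply/eqP/imsetP.
      move/(congr1 val) => /= E; have Ea := divn_eq a d.
      (* Bezout: km * m is congruent to d modulo n, so a - i, which is a
         multiple of d, is a multiple of m modulo n. *)
      case: (egcdnP n hm) => km kn Ek _.
      have hs : ((a %/ d * km) %% l < l)%N by rewrite ltn_pmod //; lia.
      exists (Ordinal hs) => //; apply: val_inj => /=.
      rewrite -[LHS](modn_small (ltn_ord a)) {1}Ea E addnC; apply/eqP.
      rewrite eqn_modDl.
      have /eqP -> : ((a %/ d * km) %% l * m == a %/ d * km * m %[mod n])%N.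
        by rewrite modl modn_mod.
      by rewrite -mulnA Ek mulnDr mulnA modnMDl.
    case=> s _ ->; apply: val_inj => /=.
    rewrite modn_dvdm // -modnDmr.
    have /eqP -> : (s * m == 0 %[mod d])%N by rewrite mod0n -/(dvdn _ _) dvdn_mull ?dvdn_gcdl.
    by rewrite mod0n addn0 modn_small.
  + exact: circle_edgeC.
  + exact: circle_edgexx.
  + move=> s t /andP[st tl]; split.
      apply/eqP => /(congr1 val)/eqP; rewrite /= eqn_modDl modl.
      by rewrite !modn_small; lia.
    have step x y q : ((i + x * m) %% n + q * m == (i + y * m) %% n %[mod n])%N
        = (x + q == y %[mod l])%N.
      by rewrite modn_mod modnDml -addnA -mulnDl eqn_modDl modl.
    have step' q : (q <= p)%N -> (t + q == s %[mod l])%N || (s + q == t %[mod l])%N =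
        (t + q == s + l)%N || (s + q == t)%N.
      move=> qp; rewrite !(@modn_lt_double (_ + _)) ?(modn_small tl); [|lia|lia].
      rewrite modn_small; last lia.
      by congr (_ || _); case: ifP; lia.
    apply/existsP/orP => [[j]|].
      by rewrite /= !step step' //; have := ltn_ord j; lia.
    case=> h.
      have hj : ((t - s).-1 < p)%N by lia.
      by exists (Ordinal hj); rewrite /= !step step' /=; lia.
    have hj : ((l - (t - s)).-1 < p)%N by lia.
    by exists (Ordinal hj); rewrite /= !step step' /=; lia.
- exact: circle_edgeC.
- exact: circle_edgexx.
- move=> a b /existsP[i] E; apply: val_inj => /=.
  have H (x y : nat) : (x + i.+1 * m = y %[mod n])%N -> (x %% d = y %% d)%N.
    move/(congr1 (fun z => z %% d)%N); rewrite !modn_dvdm // => <-.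
    by rewrite -modnDmr -modnMmr (eqP (dvdn_gcdl m n)) muln0 mod0n addn0.
  by case/orP: E => /eqP/H.
Qed.

Lemma Gnum_sepcoef (p m k n : nat) : (0 < m)%N -> (0 < k)%N ->
  (m * p * k + 1 <= n)%N ->
  (Gnum p m n k)%:R = sepcoef p 0 n%:R k :> rat.
Proof.
move=> hm hk hn.
have hpn : (p * m < n)%N by nia.
transitivity ((indep_poly (circle_edge p m n) [set: 'I_n])`_k).
  rewrite coef_indep_poly; congr (_%:R); apply: eq_card => A; rewrite !inE.
  by rewrite subsetT independent_circle // andbC.
have dm : (gcdn m n <= m)%N by apply: dvdn_leq => //; apply: dvdn_gcdl.
have En := divnK (dvdn_gcdr m n).
rewrite indep_poly_circle // coef_cycle_polyX; last first.
  by rewrite ltnNge; apply/negP => h; have := leq_mul h dm; rewrite En; lia.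
by rewrite mulnC En.
Qed.

(** * The formulas *)

Local Open Scope classical_set_scope.

(** A sum over all natural numbers whose terms vanish beyond k. *)
Lemma fsum_conv (F : nat -> rat) (u v : nat -> rat) (k : nat) :
  (forall j, (j <= k)%N -> F j = u j * v (k - j)%N) ->
  (forall j, (k < j)%N -> F j = 0) ->
  \sum_(j \in [set: nat]) F j = conv u v k.
Proof.
move=> h1 h2; rewrite (fsbigE (iota 0 k.+1)) ?iota_uniq //; last first.
  by move=> j _; rewrite mem_iota add0n ltnS -ltnNge => /h2.
rewrite -[k.+1]subn0 -/(index_iota 0 k.+1) big_mkord /conv; apply: eq_big => [j|j _].
  by rewrite classical_sets.in_setT.
by apply: h1; rewrite -ltnS.
Qed.

Theorem theorem3p3 (p m k : nat) (hp : (1 <= p)%N) (hm : (1 <= m)%N)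
    (hk : (1 <= k)%N) :
  (forall n : nat, (p * m * (k - 1) <= n)%N ->
    let N : rat := n%:R in
    let P : rat := p%:R in
    let M : rat := m%:R in
    let K : rat := k%:R in
    [/\ (Hnum p m n k)%:R =
          \sum_(j \in [set: nat])
            (gbinom (M + j%:R - 2) j
             * gbinom (N + M * P + M - P * K - 1) (k%:Z - j%:Z)
             * (- P - 1) ^+ j),
        (Hnum p m n k)%:R =
          \sum_(j \in [set: nat])
            (gbinom (N + M * P - (P + 1) * K + j%:R) j
             * gbinom (N + M * P + M - P * K - 1) (k%:Z - j%:Z)
             * (P + 1) ^+ j * (- P) ^ (k%:Z - j%:Z))
      & (Hnum p m n k)%:R =
          \sum_(j \in [set: nat])
            ((N - P * j%:R) / K
             * gbinom (M + j%:R - 1) j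
             * gbinom (N + M * P + M - P * K - 1) (k%:Z - j%:Z - 1)
             * (- P - 1) ^+ j)])
  /\
  (forall n : nat, (m * p * k + 1 <= n)%N ->
    (Gnum p m n k)%:R =
      n%:R / (n%:R - p%:R * k%:R) * gbinom (n%:R - p%:R * k%:R : rat) k).
Proof.
have neg_binom (x : rat) (z : int) : z < 0 -> gbinom x z = 0 by case: z.
split=> n hn; last first.
  rewrite Gnum_sepcoef // sepcoef_m0E // -natrM -natrB; last by nia.
  by rewrite pnatr_eq0; nia.
have pk_le : (p * k <= n + m * p)%N.
  by case: k hk hn => // k _ hn; nia.
move=> N P M K.
(* The common upper parameter is a natural number. *)
pose a := (n + m * p + m - p * k - 1)%N.
have aE : N + M * P + M - P * K - 1 = a%:R.
  by rewrite /a natrB ?natrB ?natrD ?natrM //; lia.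
have HE : (Hnum p m n k)%:R = conv (ncoef p m%:R) (bin a%:R) k.
  rewrite Hnum_sepcoef // /sepcoef; congr (conv _ (bin _) _); rewrite -aE natrD natrM; ring.
rewrite aE HE; split.
- symmetry; apply: fsum_conv => [j jk|j kj]; last first.
    by rewrite (neg_binom _ (_ - _)) ?mulr0 ?mul0r //; lia.
  by rewrite subzn // /ncoef mulrAC.
- rewrite -conv_nbin_sbin; symmetry; apply: fsum_conv => [j jk|j kj]; last first.
    by rewrite (neg_binom _ (_ - _)) ?mulr0 ?mul0r //; lia.
  rewrite subzn // /nbin /sbin -exprnP -aE /bin -/M -/K -/P -/N.
  have -> : N + M * P + M - P * K - 1 - (M - 1) - K = N + M * P - (P + 1) * K by ring.
  by ring.
- have k0 : K != 0 by rewrite pnatr_eq0; lia.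
  apply: (mulfI k0); case: k hk hn pk_le @K @a aE HE k0 => // k _ _ _ K a aE _ k0.
  rewrite mul_conv_ncoef.
  rewrite -[RHS](_ : K * conv (fun j => (N - P * j%:R) / K * ncoef p m.+1%:R j) (bin a%:R) k = _).
    rewrite -convZl; apply: eq_conv => // j _.
    rewrite [RHS](_ : _ = (N - P * j%:R) * ncoef p m.+1%:R j);
      last by rewrite mulrA [K * _]mulrC divfK.
    rewrite -/P -/M; congr ((_ - _) * _).
    by rewrite -aE /K -(@natr1 _ k); ring.
  congr (_ * _); symmetry; apply: fsum_conv => [j jk|j kj]; last first.
    by rewrite (neg_binom _ (_ - _)) ?mulr0 ?mul0r //; lia.
  have -> : k.+1%:Z - j%:Z - 1 = (k - j)%N by lia.
  rewrite /ncoef /bin.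
  have -> : m.+1%:R + j%:R - 2 = M + j%:R - 1 by rewrite /M -(@natr1 _ m); ring.
  by ring.
Qed.
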